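(* For every $n\ge1$, the loops $A\in\boldsymbol\Lambda_W(n)$ that admit an exact factorization $$A=A_-\,\Delta_{\mathbf q}\,A_+,\qquad A_\pm\in\mathrm{GL}\big(\mathfrak{W}^\pm_{\mathbb{Q}}(n)\big),\quad \mathbf q=(q_1,\dots,q_n)\in\mathbb{Q}^n,\quad \Delta_{\mathbf q}=\operatorname{diag}(\chi_{q_1},\dots,\chi_{q_n}),$$ are dense in $\boldsymbol\Lambda_W(n)$ for the Wiener norm.
   Context: The universal solenoid is $S^1_{\mathbb{Q}}=\varprojlim S^1$ over positive integers ordered by divisibility, with bonding maps $z\mapsto z^{m/n}$ for $n\mid m$; it is a compact connected abelian group with Pontryagin dual the discrete group $\mathbb{Q}$. For $q=k/N\in\mathbb{Q}$ the corresponding character is $\chi_q(\mathbf{u})=\pi_N(\mathbf{u})^k$, where $\pi_N:S^1_{\mathbb{Q}}\to S^1$ is the projection to level $N$. The matrix Wiener algebra $\mathfrak{W}_{\mathbb{Q}}(n)$ is the Banach algebra of functions $f=\sum_{q\in\mathbb{Q}}A_q\chi_q:S^1_{\mathbb{Q}}\to M_n(\mathbb{C})$ with Wiener norm $\|f\|=\sum_{q\in\mathbb{Q}}\|A_q\|<\infty$, where $\|\cdot\|$ on $M_n(\mathbb{C})$ is a fixed submultiplicative norm. $\mathfrak{W}^+_{\mathbb{Q}}(n)$ (resp. $\mathfrak{W}^-_{\mathbb{Q}}(n)$) is the closed subalgebra of those $f$ with $A_q=0$ for $q<0$ (resp. for $q>0$). $\boldsymbol\Lambda_W(n)$ is the group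 of units of $\mathfrak{W}_{\mathbb{Q}}(n)$, equivalently the set of $f\in\mathfrak{W}_{\mathbb{Q}}(n)$ with $f(\mathbf{u})$ invertible for all $\mathbf{u}\in S^1_{\mathbb{Q}}$; $\mathrm{GL}(\mathfrak{W}^\pm_{\mathbb{Q}}(n))$ is the group of units of $\mathfrak{W}^\pm_{\mathbb{Q}}(n)$. *)

(* Defs.v *)
From HB Require Import structures.
From mathcomp Require Import all_boot all_order all_algebra ssrAC lra.
From mathcomp Require Import finmap complex.
From mathcomp Require Import summability.
From mathcomp Require Import all_classical all_reals all_analysis.

Set Implicit Arguments.
Unset Strict Implicit.
Unset Printing Implicit Defensive.

Import Order.TTheory GRing.Theory Num.Theory.
Import numFieldNormedType.Exports.

Local Open Scope classical_set_scope.
Local Open Scope ring_scope.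
Local Open Scope complex_scope.

Definition level := {N : nat | (0 < N)%N}.

(* A thread of the inverse system: [thread N] is the projection [pi_N]. *)
Record solenoid (R : realType) := Solenoid {
  thread :> level -> R[i];
  thread_circle : forall N : level, `|thread N| = 1;
  thread_bond : forall n m : level, (val n %| val m)%N ->
    thread n = thread m ^+ (val m %/ val n) }.

Lemma absz_denq_gt0 (q : rat) : (0 < `|denq q|)%N.
Proof. by rewrite absz_gt0 denq_neq0. Qed.

Definition denq_level (q : rat) : level := exist _ `|denq q|%N (absz_denq_gt0 q).

(* The fraction is taken in lowest terms; [chi_frac] below shows that every
   other representation k / N gives the same value. *)
Definition chi (R : realType) (q : rat) (u : solenoid R) : R[i] :=
  u (denq_level q) ^ numq q.

Definition Delta (R : realType) (n : nat) (q : 'I_n -> rat) (u : solenoid R) :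
  'M[R[i]]_n := diag_mx (\row_(j < n) chi (q j) u).

Record submult_norm (R : realType) (n : nat) := SubmultNorm {
  mxnorm :> 'M[R[i]]_n -> R;
  mxnorm_eq0 : forall A, mxnorm A = 0 -> A = 0;
  mxnormD : forall A B, mxnorm (A + B) <= mxnorm A + mxnorm B;
  mxnormZ : forall (a : R[i]) A, (mxnorm (a *: A))%:C = `|a| * (mxnorm A)%:C;
  mxnormM : forall A B, mxnorm (A *m B) <= mxnorm A * mxnorm B }.

Section Wiener.
Variables (R : realType) (n : nat) (N : submult_norm R n).
Implicit Types (f g : solenoid R -> 'M[R[i]]_n) (c : rat -> 'M[R[i]]_n).

(* The series is summed unconditionally, along the finite sets of rationals. *)
Definition wiener_expansion f c :=
  (\esum_(q in [set: rat]) (N (c q))%:E < +oo)%E /\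
  forall u : solenoid R,
    (fun F : {fset rat} => N (f u - \sum_(q <- F) chi q u *: c q)) @ totally
      --> (0 : R).

Definition wiener : set (solenoid R -> 'M[R[i]]_n) :=
  [set f | exists c, wiener_expansion f c].

(* The coefficients are unique ([wiener_expansion_uniq]), so that the choice
   involved is immaterial for [f] in [wiener]; elsewhere they are 0. *)
Definition wiener_coef f : rat -> 'M[R[i]]_n :=
  xget (fun=> 0) (wiener_expansion f).

Definition wiener_norm f : \bar R :=
  (\esum_(q in [set: rat]) (N (wiener_coef f q))%:E)%E.

Definition wiener_plus : set (solenoid R -> 'M[R[i]]_n) :=
  [set f | wiener f /\ forall q : rat, q < 0 -> wiener_coef f q = 0].

Definition wiener_minus : set (solenoid R -> 'M[R[i]]_n) :=
  [set f | wiener f /\ forall q : rat, 0 < q -> wiener_coef f q = 0].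

End Wiener.

Definition units_of (R : realType) (n : nat)
    (S : set (solenoid R -> 'M[R[i]]_n)) : set (solenoid R -> 'M[R[i]]_n) :=
  [set f | S f /\ exists2 g, S g &
     forall u, f u *m g u = 1%:M /\ g u *m f u = 1%:M].

Definition Lambda_W (R : realType) (n : nat) (N : submult_norm R n) :=
  units_of (wiener N).

Definition exact_factorization (R : realType) (n : nat) (N : submult_norm R n)
    (A : solenoid R -> 'M[R[i]]_n) : Prop :=
  exists (Am Ap : solenoid R -> 'M[R[i]]_n) (q : 'I_n -> rat),
    [/\ units_of (wiener_minus N) Am, units_of (wiener_plus N) Ap &
        forall u, A u = Am u *m Delta q u *m Ap u].

Section Characters.
Variable R : realType.
Implicit Types (u : solenoid R) (q : rat).

Lemma thread_neq0 u (N : level) : u N != 0.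
Proof. by rewrite -normr_eq0 thread_circle oner_eq0. Qed.

Lemma chi_frac (k : int) (N : level) u :
  chi (k%:~R / (val N)%:R) u = u N ^ k.
Proof.
case: N => N N0 /=; rewrite /chi.
have Nz : N%:Z != 0 :> int by rewrite eqz_nat -lt0n.
set q := k%:~R / _.
have qE : q = k%:~R / N%:Z%:~R by [].
have kd : numq q * N%:Z = k * denq q.
  apply: (@intr_inj rat); rewrite !intrM numqE qE mulrAC divfK //.
  by rewrite intr_eq0.
have dN : (`|denq q| %| N)%N.
  rewrite -(@Gauss_dvdr _ `|numq q|); last by rewrite coprime_sym coprime_num_den.
  by have := congr1 absz kd; rewrite !abszM /= => ->; rewrite dvdn_mull.
have eN : (N %/ `|denq q|)%:Z * numq q = k.
  have d0 : denq q != 0 by rewrite denq_neq0.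
  apply: (mulIf d0); rewrite -kd -mulrA mulrC -mulrA; congr (_ * _).
  by rewrite -{1}(gtz0_abs (denq_gt0 q)) -PoszM mulnC divnK.
rewrite (thread_bond u (m := exist _ N N0) (n := denq_level q)) //=.
by rewrite exprnP exprz_exp eN.
Qed.

Lemma normr_chi q u : `|chi q u| = 1.
Proof.
rewrite /chi; case: (numq q) => k; rewrite ?NegzE -?exprnP -?exprnN ?normfV
  normrX thread_circle expr1n ?invr1 //.
Qed.

Lemma chi_neq0 q u : chi q u != 0.
Proof. by rewrite -normr_eq0 normr_chi oner_eq0. Qed.

End Characters.

Section Circle.
Variable R : realType.
Implicit Types x y t : R.

Definition cis x : R[i] := cos x +i* sin x.

Lemma cisD x y : cis (x + y) = cis x * cis y.
Proof. by rewrite /cis cosD sinD; simpc; congr (_ +i* _); rewrite addrC. Qed.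

Lemma cis0 : cis 0 = 1.
Proof. by rewrite /cis cos0 sin0. Qed.

Lemma cisMn x m : cis (x *+ m) = cis x ^+ m.
Proof.
by elim: m => [|m IH]; rewrite ?mulr0n ?cis0// mulrS cisD IH exprS.
Qed.

Lemma norm_cis x : `|cis x| = 1.
Proof. by rewrite /cis normc_def /= cos2Dsin2 sqrtr1. Qed.

Lemma cis_neq0 x : cis x != 0.
Proof. by rewrite -normr_eq0 norm_cis oner_eq0. Qed.

Lemma cisN x : cis (- x) = (cis x)^-1.
Proof.
by apply: (mulIf (cis_neq0 x)); rewrite mulVf ?cis_neq0// -cisD addNr cis0.
Qed.

Lemma cisMz x (k : int) : cis (x *~ k) = cis x ^ k.
Proof.
case: k => k; first by rewrite -pmulrn cisMn.
by rewrite NegzE mulrNz cisN -pmulrn cisMn exprnN.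
Qed.

Lemma cis_2pi_int (k : int) : cis (pi *+ 2 *~ k) = 1.
Proof. by rewrite cisMz /cis cos2pi sin2pi exp1rz. Qed.

Lemma cis_neq1 x : x != 0 -> `|x| < pi -> cis x != 1.
Proof.
move=> x0 xpi; apply/eqP => -[_]; apply/eqP.
case: (ltrgtP x 0) x0 => // [x_lt0|x_gt0] _.
  rewrite -oppr_eq0 -sinN gt_eqF// sin_gt0_pi// oppr_gt0 x_lt0.
  by rewrite -ltr0_norm.
by rewrite gt_eqF// sin_gt0_pi// x_gt0 -(gtr0_norm x_gt0).
Qed.

Definition loop_thread t (N : level) : R[i] := cis (pi *+ 2 * t / (val N)%:R).

Lemma loop_bond t (n m : level) : (val n %| val m)%N ->
  loop_thread t n = loop_thread t m ^+ (val m %/ val n).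
Proof.
case: n m => [n n0] [m m0] /= nm; rewrite /loop_thread /= -cisMn; congr cis.
case/dvdnP: nm m0 => p ->; rewrite muln_gt0 => /andP[p0 _].
rewrite mulnK// -[RHS]mulr_natr natrM invfM mulrA [RHS]mulrAC divfK//.
by rewrite pnatr_eq0 -lt0n.
Qed.

(* The image of t under the dense one-parameter subgroup of the solenoid. *)
Definition loop t : solenoid R :=
  Solenoid (fun N => norm_cis (pi *+ 2 * t / (val N)%:R)) (@loop_bond t).

Lemma chi_loop q t : chi q (loop t) = cis (pi *+ 2 * t * ratr q).
Proof.
rewrite /chi /= /loop_thread /= -cisMz; congr cis.
rewrite -mulrzr -(mulrA (pi *+ 2 * t)); congr (_ * _).
rewrite /ratr [LHS]mulrC; congr (_ / _).
by rewrite -[in RHS](gtz0_abs (denq_gt0 q)).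
Qed.

Lemma chi_orthogonality (F : seq rat) (q0 : rat) :
  exists (M : nat) (u : nat -> solenoid R), (0 < M)%N /\
    forall q, q \in F -> q != q0 ->
      \sum_(k < M) chi q (u k) / chi q0 (u k) = 0.
Proof.
pose L := (\prod_(q <- F) `|denq (q - q0)|)%N.
have L0 : (0 < L)%N by apply: prodn_gt0 => q; apply: absz_denq_gt0.
pose a q := numq (q - q0) * (L %/ `|denq (q - q0)|)%:Z.
have aE q : q \in F -> (a q)%:~R = (q - q0) * L%:R :> rat.
  move=> qF; have dL : (`|denq (q - q0)| %| L)%N by rewrite /L (big_rem q)//= dvdn_mulr.
  rewrite /a intrM numqE -mulrA; congr (_ * _).
  rewrite -{1}(gtz0_abs (denq_gt0 (q - q0))) -intrM -PoszM mulnC divnK//.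
pose M := (\sum_(q <- F) `|a q| * 2).+1.
have M0 : M%:R != 0 :> R by rewrite pnatr_eq0.
exists M, (fun k => loop (k%:R * L%:R / M%:R)); split=> // q qF qq0.
pose z := cis (pi *+ 2 * (a q)%:~R / M%:R).
have E (k : nat) : chi q (loop (k%:R * L%:R / M%:R)) /
    chi q0 (loop (k%:R * L%:R / M%:R)) = z ^+ k.
  rewrite !chi_loop -cisN -cisD -cisMn; congr cis.
  rewrite -mulrBr -rmorphB /= -[RHS]mulr_natr -(ratr_int R (a q)) aE// rmorphM /=.
  rewrite ratr_nat; move: (ratr _) => r.
  by rewrite !mulrA [RHS](ACl (1*5*3*4*2)).
under eq_bigr do rewrite E.
have aq0 : a q != 0.
  rewrite -(intr_eq0 rat) aE// mulf_neq0 ?subr_eq0//.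
  by rewrite pnatr_eq0 -lt0n.
have aM : (`|a q| * 2 < M)%N by rewrite ltnS (big_rem q)//= leq_addr.
have z1 : z != 1.
  apply: cis_neq1.
    by rewrite !mulf_neq0 ?invr_eq0 ?intr_eq0// mulrn_eq0 /= gt_eqF ?pi_gt0.
  rewrite !normrM normfV normrMn (gtr0_norm (pi_gt0 R)) normr_nat.
  rewrite ltr_pdivrMr ?ltr0n// -[pi *+ 2]mulr_natr -mulrA ltr_pM2l ?pi_gt0//.
  by rewrite -intr_norm -abszE -natrM ltr_nat mulnC.
apply/eqP; move: z1; rewrite -subr_eq0 => z1; rewrite -(mulrI_eq0 _ (mulfI z1)).
rewrite -subrX1 -cisMn -[_ *+ M]mulr_natr divfK//.
by rewrite mulrzr cis_2pi_int subrr.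
Qed.

End Circle.

#[global] Instance totally_proper (I : choiceType) : ProperFilter (@totally I).
Proof. exact: totally_filter. Qed.

Section Uniqueness.
Variables (R : realType) (n : nat) (N : submult_norm R n).
Implicit Types (f g : solenoid R -> 'M[R[i]]_n) (c d : rat -> 'M[R[i]]_n).

Lemma mxnorm0 : N 0 = 0.
Proof.
by apply: (@complexI R); rewrite -(scale0r 0) mxnormZ normr0 mul0r.
Qed.

Lemma mxnormZ1 (a : R[i]) A : `|a| = 1 -> N (a *: A) = N A.
Proof. by move=> a1; apply: (@complexI R); rewrite mxnormZ a1 mul1r. Qed.

Lemma mxnormN A : N (- A) = N A.
Proof. by rewrite -scaleN1r mxnormZ1// normrN1. Qed.

Lemma mxnorm_ge0 A : 0 <= N A.
Proof.
have := mxnormD N A (- A); rewrite subrr mxnorm0 mxnormN -mulr2n.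
by rewrite pmulrn_lge0.
Qed.

Lemma mxnormMn A m : N (A *+ m) = N A *+ m.
Proof.
apply: (@complexI R); rewrite -scaler_nat mxnormZ normr_nat mulr_natl.
by rewrite rmorphMn.
Qed.

Lemma mxnorm_sum (I : Type) (s : seq I) (P : pred I) (A : I -> 'M[R[i]]_n) :
  N (\sum_(i <- s | P i) A i) <= \sum_(i <- s | P i) N (A i).
Proof.
elim/big_rec2: _ => [|i x y _ h]; first by rewrite mxnorm0.
by rewrite (le_trans (mxnormD _ _ _))// lerD2l.
Qed.

Lemma esum_tail (a : rat -> R) (e : R) : (forall q, 0 <= a q) -> 0 < e ->
  (\esum_(q in [set: rat]) (a q)%:E < +oo)%E ->
  exists F : {fset rat}, forall G : {fset rat}, (F `<=` G)%fset ->
    \sum_(q <- (G `\` F)%fset) a q <= e.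
Proof.
move=> a0 e0 afin.
have sfin : (\esum_(q in [set: rat]) (a q)%:E)%E \is a fin_num.
  by rewrite ge0_fin_numE// esum_ge0// => q _; rewrite lee_fin.
have [_ [A [finA _] <-] sA] := ub_ereal_sup_adherent e0 sfin.
exists (fset_set A) => G AG.
have : (\sum_(q <- G) (a q)%:E <= \esum_(q in [set: rat]) (a q)%:E)%E.
  apply: esum_ge; exists [set` G]; first by split.
  by rewrite fsbig_finite//= set_fsetK.
rewrite (big_fsetID _ (mem (fset_set A)))/=.
move: sA; rewrite fsbig_finite//=.
move: sfin; rewrite -/(esum _ _) => /fineK <-; move: (fine _) => s.
rewrite !sumEFin -EFinB lte_fin -EFinD lee_fin.
have -> : [fset x | x in G & x \in fset_set A]%fset = fset_set A.
  apply/fsetP => x; rewrite !inE/=; apply/andP/idP => [[]//|xA].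
  by split=> //; exact: (fsubsetP AG).
have -> : [fset x | x in G & x \notin fset_set A]%fset = (G `\` fset_set A)%fset.
  by apply/fsetP => x; rewrite !inE/= andbC.
lra.
Qed.

Lemma null_expansion_coef d (q0 : rat) :
  (\esum_(q in [set: rat]) (N (d q))%:E < +oo)%E ->
  (forall u, (fun F : {fset rat} => N (\sum_(q <- F) chi q u *: d q)) @ totally
    --> (0 : R)) ->
  d q0 = 0.
Proof.
move=> dfin dcvg; apply: (mxnorm_eq0 (s := N)); apply/eqP.
rewrite eq_le mxnorm_ge0 andbT; apply/ler_addgt0Pr => e e0; rewrite add0r.
have e20 : 0 < e / 2 by rewrite divr_gt0.
have [F0 tailF0] := esum_tail (fun q => mxnorm_ge0 (d q)) e20 dfin.
pose F := (q0 |` F0)%fset.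
have small u : N (\sum_(q <- F) chi q u *: d q) <= e.
  have /cvgrPdist_lt /(_ _ e20) [F1 _ F1P] := dcvg u.
  pose G := (F `|` F1)%fset.
  have := F1P G (fsubsetUr _ _); rewrite /= sub0r normrN ger0_norm ?mxnorm_ge0//.
  move=> sG.
  have FG : (F `<=` G)%fset by exact: fsubsetUl.
  have sub : N (\sum_(q <- (G `\` F)%fset) chi q u *: d q) <= e / 2.
    rewrite (le_trans (mxnorm_sum _ _ _))//.
    rewrite (eq_bigr (fun q => N (d q))); last first.
      by move=> q _; rewrite mxnormZ1// normr_chi.
    have F0F : (F0 `<=` F)%fset by exact: fsubsetUr.
    rewrite (le_trans _ (tailF0 G (fsubset_trans F0F FG)))//.
    rewrite [leRHS](big_fsetID _ (mem F))/= -[leLHS]add0r lerD//.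
      by rewrite sumr_ge0// => q _; exact: mxnorm_ge0.
    rewrite le_eqVlt; apply/orP; left; apply/eqP; congr bigop.body.
    congr enum_fset; apply/fsetP => x; rewrite !inE /=.
    by case: (x == q0); case: (x \in F0) => //=; rewrite ?andbF ?andbT.
  move: sG; rewrite (big_fsetID _ (mem F))/=.
  have -> : [fset x | x in G & x \in F]%fset = F.
    apply/fsetP => x; rewrite !inE/=.
    by case: (x == q0); case: (x \in F0) => //=; rewrite ?andbF.
  have -> : [fset x | x in G & x \notin F]%fset = (G `\` F)%fset.
    by apply/fsetP => x; rewrite !inE/= andbC.
  set S := \sum_(q <- F) _; set T := \sum_(q <- _) _ in sub *.
  move=> sG; have := mxnormD N (S + T) (- T); rewrite addrK mxnormN.
  lra.
have [M [u [M0 uP]]] := chi_orthogonality R F q0.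
have avg : \sum_(k < M) (chi q0 (u k))^-1 *: \sum_(q <- F) chi q (u k) *: d q
    = d q0 *+ M.
  under eq_bigr do rewrite scaler_sumr.
  rewrite exchange_big /= (big_fsetD1 q0) ?fset1U1//=.
  rewrite [X in _ + X]big1_seq ?addr0; last first.
    move=> q /andP[_]; rewrite in_fsetD1 => /andP[qq0 qF].
    under eq_bigr do rewrite scalerA mulrC.
    by rewrite -scaler_suml uP// scale0r.
  under eq_bigr do rewrite scalerA mulVf ?chi_neq0// scale1r.
  by rewrite sumr_const card_ord.
rewrite -(ler_pMn2r M0) -mxnormMn -avg (le_trans (mxnorm_sum _ _ _))//.
rewrite -[X in _ *+ X]card_ord -sumr_const ler_sum// => k _.
by rewrite mxnormZ1 ?small// normfV normr_chi invr1.
Qed.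

Lemma wiener_expansionB f g c d :
  wiener_expansion N f c -> wiener_expansion N g d ->
  wiener_expansion N (fun u => f u - g u) (fun q => c q - d q).
Proof.
move=> [cfin cf] [dfin dg]; split.
  apply: (@le_lt_trans _ _
      (\esum_(q in [set: rat]) ((N (c q))%:E + (N (d q))%:E))%E).
    apply: le_esum => q _.
    by rewrite lee_fin (le_trans (mxnormD _ _ _))// mxnormN.
  rewrite esumD; last 2 first.
  - by move=> q _; rewrite lee_fin mxnorm_ge0.
  - by move=> q _; rewrite lee_fin mxnorm_ge0.
  by rewrite lte_add_pinfty.
move=> u; have := cvgD (cf u) (dg u); rewrite addr0 => cdg.
apply: (squeeze_cvgr _ (cvg_cst (0 : R)) (cdg _)).
apply: nearW => F; rewrite mxnorm_ge0 /=.
have -> : f u - g u - \sum_(q <- F) chi q u *: (c q - d q) =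
    (f u - \sum_(q <- F) chi q u *: c q) - (g u - \sum_(q <- F) chi q u *: d q).
  under eq_bigr do rewrite scalerBr.
  by rewrite sumrB !opprD !opprK addrACA.
by rewrite (le_trans (mxnormD _ _ _))// mxnormN.
Qed.

Lemma wienerB f g : wiener N f -> wiener N g -> wiener N (fun u => f u - g u).
Proof.
by move=> [c fc] [d gd]; exists (fun q => c q - d q); apply: wiener_expansionB.
Qed.

Lemma wiener_expansion_uniq f c d :
  wiener_expansion N f c -> wiener_expansion N f d -> c = d.
Proof.
move=> fc fd; apply/funext => q0; apply/eqP; rewrite -subr_eq0; apply/eqP.
have [cdfin cd] := wiener_expansionB fc fd.
apply: (null_expansion_coef (d := fun q => c q - d q)) => // u.
have := cd u; rewrite subrr; apply: cvg_trans; apply: near_eq_cvg.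
by apply: nearW => F; rewrite sub0r mxnormN.
Qed.

Lemma wiener_coefE f c : wiener_expansion N f c -> wiener_coef N f = c.
Proof.
move=> fc; apply: (wiener_expansion_uniq (f := f)) => //.
by rewrite /wiener_coef; apply: xgetPex; exists c.
Qed.

Lemma wiener_normE f c : wiener_expansion N f c ->
  wiener_norm N f = (\esum_(q in [set: rat]) (N (c q))%:E)%E.
Proof. by rewrite /wiener_norm => /wiener_coefE ->. Qed.

End Uniqueness.

(* Main.v *)
Require Import Defs.
From mathcomp Require Import all_boot all_order all_algebra.
From mathcomp Require Import complex finmap summability ring lra.
From mathcomp Require Import all_classical all_reals all_analysis.

Import Order.TTheory GRing.Theory Num.Theory.
Import numFieldNormedType.Exports.

Local Open Scope classical_set_scope.
Local Open Scope ring_scope.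

Set Implicit Arguments.
Unset Strict Implicit.
Unset Printing Implicit Defensive.

(** The approximating loop is a trigonometric polynomial P, a finite partial
    sum of the expansion of A.  Three facts make it work.

    - Invertibility of P.  The norm of A^-1 (A - P) at a point is at most the
      Wiener norm of A^-1 times that of A - P; once this is below 1, the matrix
      A^-1 P = 1 - A^-1 (A - P) has nonzero determinant everywhere
      ([det_1sub_neq0]), hence so has P.  No invertibility in the Wiener algebra
      is claimed at this point.

    - Reduction to the circle.  Finitely many rational frequencies have a common
      denominator L, so P(u) = z^-m Q(z) with z = chi_(1/L)(u) and Q a matrix
      of polynomials ([trig_polynomial]).  The character chi_(1/L) is onto the
      circle ([chi_surj]), so det Q has no zero on the circle.

    - Wiener-Hopf factorization of Q ([polynomial_wiener_hopf]), by pure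
      algebra: Q(z) = M(1/z) diag(z^k_j) G(z), with M and G matrices of
      polynomials whose determinants do not vanish on the closed unit disk.
      First the zeros of det Q outside the disk are moved, one at a time, into
      a right factor E ([root_splitting]).  The remaining left factor Q1 is then
      multiplied on the right by a unimodular U that makes it column reduced
      ([column_reduction]): the matrix of the coefficients of degree k_j in the
      columns j of Q1 U is invertible, where k_j bounds the degrees in column j.
      Reversing each column j of Q1 U at degree k_j gives M, for which that
      coefficient matrix is M(0); and G = U^-1 E.

    It remains to see that M(1/z) and G(z) are units of the half algebras, and
    that P is a unit of the full one.  An inverse is an adjugate divided by a
    determinant, so this comes down to dividing an absolutely convergent power
    series by 1 - a w with |a| < 1 ([power_series_div1]), which is an explicit
    recursion on coefficients.  For P itself det Q has zeros on both sides of the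
    circle; a Bezout relation splits 1 / det Q into a part analytic inside and a
    part analytic outside ([bezout_splitting]).  Products of general elements of
    the Wiener algebra never occur. *)

(** * Matrices of polynomials and Wiener-Hopf factorization on the circle *)

Definition mxeval (C : comNzRingType) (n : nat) (z : C) (Q : 'M[{poly C}]_n) :
  'M[C]_n := map_mx (horner_eval z) Q.

Section PolynomialMatrices.
Variables (C : fieldType) (n : nat).
Implicit Types (Q U E : 'M[{poly C}]_n) (z : C).

Lemma mxevalM z Q E : mxeval z (Q *m E) = mxeval z Q *m mxeval z E.
Proof. exact: map_mxM. Qed.

Lemma det_mxeval z Q : \det (mxeval z Q) = (\det Q).[z].
Proof. exact: det_map_mx. Qed.

Lemma mxeval_adj z Q : mxeval z (\adj Q) = \adj (mxeval z Q).
Proof. exact: map_mx_adj. Qed.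

(** Every column operation below is a right multiplication by such a matrix, and
    is invertible exactly when [t j0] is. *)
Definition colrepl (A : comNzRingType) (j0 : 'I_n) (t : 'I_n -> A) : 'M[A]_n :=
  \matrix_(i, j) if j == j0 then t i else (i == j)%:R.

Lemma det_colrepl (A : comNzRingType) (j0 : 'I_n) (t : 'I_n -> A) :
  \det (colrepl j0 t) = t j0.
Proof.
rewrite (expand_det_row _ j0) (bigD1 j0) //= big1 ?addr0; last first.
  by move=> j /negPf jj0; rewrite mxE jj0 eq_sym jj0 mul0r.
rewrite mxE eqxx /cofactor addnn -muln2 exprM sqrr_sign mul1r.
rewrite (_ : row' _ _ = 1%:M) ?det1 ?mulr1//.
apply/matrixP => i j; rewrite !mxE eq_sym (negPf (neq_lift _ _)).
by rewrite (inj_eq lift_inj).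
Qed.

Lemma mul_colrepl (A : comNzRingType) (Q : 'M[A]_n) (j0 : 'I_n) (t : 'I_n -> A) i j :
  (Q *m colrepl j0 t) i j = if j == j0 then \sum_l Q i l * t l else Q i j.
Proof.
rewrite mxE; case: eqVneq => [->|jj0].
  by apply: eq_bigr => l _; rewrite mxE eqxx.
rewrite (bigD1 j) //= big1 => [|l lj]; rewrite mxE (negPf jj0).
  by rewrite eqxx mulr1 addr0.
by rewrite (negPf lj) mulr0.
Qed.

Lemma det0_ker (H : 'M[C]_n) : \det H = 0 ->
  exists2 v : 'I_n -> C, exists j, v j != 0 & forall i, \sum_l H i l * v l = 0.
Proof.
rewrite -det_tr => /eqP/det0P[v v0 vH]; exists (v 0).
  have [j vj] : exists j, v 0 j != 0; last by exists j.
  apply/existsP; apply: contraNT v0; rewrite negb_exists => /forallP h.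
  by apply/eqP/rowP => j; rewrite mxE; apply/eqP; have := h j; rewrite negbK.
move=> i; have := congr1 (fun A : 'rV_n => A 0 i) vH; rewrite mxE [RHS]mxE.
by under eq_bigr do rewrite mxE mulrC.
Qed.

Definition colcoef Q (k : 'I_n -> nat) : 'M[C]_n :=
  \matrix_(i, j) (Q i j)`_(k j).

(** If the leading coefficient matrix is singular, a kernel vector [v] gives a
    combination of the columns, each multiplied by a power of ['X] that raises its
    bound [k l] to the largest one among the columns with [v l != 0], in which the
    top coefficients cancel.  Replacing a column that attains this largest bound
    is a unimodular operation that lowers its bound by 1.  A bound 0 cannot occur there,
    since the new column would vanish and with it the determinant; so the sum of
    the bounds decreases. *)
Lemma column_reduction Q (k : 'I_n -> nat) : \det Q != 0 ->
  (forall i j, (size (Q i j) <= (k j).+1)%N) ->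
  exists U (k' : 'I_n -> nat), [/\ U \in unitmx,
    forall i j, (size ((Q *m U) i j) <= (k' j).+1)%N &
    \det (colcoef (Q *m U) k') != 0].
Proof.
have [s] := ubnP (\sum_j k j); elim: s Q k => // s IH Q k ks Q0 szQ.
have [H0|?] := eqVneq (\det (colcoef Q k)) 0; last first.
  by exists 1%:M, k; rewrite unitmx1 mulmx1.
have [v [j1 vj1] Hv] := det0_ker H0.
have [j0 vj0 maxj0] : exists2 j0, v j0 != 0 &
    forall j, v j != 0 -> (k j <= k j0)%N.
  by have [j0 ? ?] := @arg_maxnP _ j1 (fun j => v j != 0) k vj1; exists j0.
pose t l := (v l)%:P * 'X^(k j0 - k l).
have tj0 : t j0 = (v j0)%:P by rewrite /t subnn mulr1.
have T1 : colrepl j0 t \in unitmx.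
  by rewrite unitmxE det_colrepl tj0 poly_unitE coefC size_polyC vj0 unitfE.
pose Q' := Q *m colrepl j0 t.
have Q'0 : \det Q' != 0.
  by rewrite det_mulmx det_colrepl mulf_neq0// tj0 polyC_eq0.
have szt i l : (size (Q i l * t l)%R <= (k j0).+1)%N.
  rewrite /t; have [->|vl] := eqVneq (v l) 0; first by rewrite mul0r mulr0 size_poly0.
  rewrite mulrCA mul_polyC (leq_trans (size_scale_leq _ _))//.
  rewrite (leq_trans (size_polyMleq _ _))// size_polyXn addnS /=.
  by rewrite (leq_trans (leq_add (szQ i l) (leqnn _)))// addSn subnKC// maxj0.
have szQ' i : (size (Q' i j0) <= k j0)%N.
  have szQ' : (size (Q' i j0) <= (k j0).+1)%N.
    rewrite mul_colrepl eqxx (leq_trans (size_sum _ _ _))//.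
    by apply/bigmax_leqP => l _; exact: szt.
  have c0 : (Q' i j0)`_(k j0) = 0.
    rewrite mul_colrepl eqxx coef_sum -[RHS](Hv i); apply: eq_bigr => l _.
    rewrite /t mxE; have [->|vl] := eqVneq (v l) 0.
      by rewrite mul0r !mulr0 coef0.
    rewrite mulrCA coefCM coefMXn ltnNge leq_subr /= subKn ?maxj0//.
    exact: mulrC.
  apply/leq_sizeP => m; rewrite leq_eqVlt => /predU1P[<-//|jm].
  by rewrite nth_default// (leq_trans szQ').
have kj0 : (0 < k j0)%N.
  rewrite lt0n; apply: contra Q'0 => /eqP k0.
  rewrite (expand_det_col _ j0) big1// => i _.
  have := szQ' i; rewrite k0 leqn0 size_poly_eq0 => /eqP ->.
  by rewrite mul0r.
pose k' j := if j == j0 then (k j0).-1 else k j.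
have [U [k'' [U1 szU H1]]] : exists U (k'' : 'I_n -> nat), [/\ U \in unitmx,
    forall i j, (size ((Q' *m U) i j) <= (k'' j).+1)%N &
    \det (colcoef (Q' *m U) k'') != 0].
  apply: (IH _ k') => // [|i j].
    rewrite -ltnS (leq_trans _ ks)// ltnS (bigD1 j0)//= [X in (_ < X)%N](bigD1 j0)//=.
    rewrite /k' eqxx; under eq_bigr => j /negPf -> do [].
    by rewrite ltn_add2r prednK.
  rewrite /k'; case: eqVneq => [->|jj0]; first by rewrite prednK.
  by rewrite mul_colrepl (negPf jj0).
exists (colrepl j0 t *m U), k''; split; rewrite ?mulmxA//.
by rewrite unitmx_mul T1.
Qed.

(** Let [b] be a zero of [\det Q] with [S b] and [v] a kernel vector of [Q] at
    [b].  Replacing a column by the combination with weights [v] makes that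
    column divisible by ['X - b%:P]; pulling this factor out to the right lowers
    the degree of the determinant. *)
Lemma root_splitting Q (S : C -> Prop) : \det Q != 0 ->
  exists Q1 E, [/\ Q = Q1 *m E, forall z, S z -> (\det Q1).[z] != 0 &
    forall z, ~ S z -> (\det E).[z] != 0].
Proof.
have [s] := ubnP (size (\det Q)); elim: s Q => // s IH Q szQ Q0.
have [[b [Sb Qb]]|noroot] := pselect (exists b, S b /\ (\det Q).[b] = 0); last first.
  exists Q, 1%:M; rewrite mulmx1; split=> // z Sz.
    by apply/eqP => Qz; apply: noroot; exists z.
  by rewrite det1 hornerC oner_eq0.
have [v [j0 vj0] Qv] : exists2 v : 'I_n -> C, exists j, v j != 0 &
    forall i, \sum_l mxeval b Q i l * v l = 0.
  by apply: det0_ker; rewrite det_mxeval.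
pose T := colrepl j0 (fun l => (v l)%:P).
have dT : \det T = (v j0)%:P by rewrite det_colrepl.
have T1 : T \in unitmx.
  by rewrite unitmxE dT poly_unitE coefC size_polyC vj0 unitfE.
pose D : 'M[{poly C}]_n := diag_mx (\row_j if j == j0 then 'X - b%:P else 1).
have dD : \det D = 'X - b%:P.
  rewrite det_diag (bigD1 j0)//= big1 ?mulr1; last first.
    by move=> j /negPf jj0; rewrite mxE jj0.
  by rewrite mxE eqxx.
pose Q' : 'M[{poly C}]_n := \matrix_(i, j)
  if j == j0 then ((Q *m T) i j) %/ ('X - b%:P) else Q i j.
have Q'D : Q' *m D = Q *m T.
  apply/matrixP => i j; rewrite mul_mx_diag [LHS]mxE [Q' i j]mxE [X in _ * X]mxE.
  rewrite mul_colrepl; case: eqVneq => _; last by rewrite mulr1.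
  rewrite divpK// dvdp_XsubCl /root horner_sum -[X in _ == X](Qv i).
  by apply/eqP; apply: eq_bigr => l _; rewrite mxE hornerM hornerC.
have dQ' : \det Q' * ('X - b%:P) = \det Q * (v j0)%:P.
  by rewrite -dD -dT -!det_mulmx Q'D.
have Q'0 : \det Q' != 0.
  apply: contraTneq (mulf_neq0 Q0 (_ : (v j0)%:P != 0)); last by rewrite polyC_eq0.
  by move=> Q'0; rewrite -dQ' Q'0 mul0r eqxx.
have [Q1 [E [Q'E Q1S ES]]] : exists Q1 E, [/\ Q' = Q1 *m E,
    forall z, S z -> (\det Q1).[z] != 0 & forall z, ~ S z -> (\det E).[z] != 0].
  apply: IH => //; rewrite -ltnS (leq_trans _ szQ)// ltnS.
  have := congr1 (fun p : {poly C} => size p) dQ'.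
  rewrite size_Mmonic ?monicXsubC// size_XsubC addn2 /= mulrC mul_polyC.
  by rewrite size_scale// => <-.
exists Q1, (E *m D *m invmx T); split=> //.
  by rewrite !mulmxA -Q'E Q'D mulmxK.
move=> z Sz; rewrite !det_mulmx dD !hornerM hornerXsubC !mulf_neq0 ?ES//.
  by rewrite subr_eq0; apply: contra_notN Sz => /eqP ->.
have : (\det T * \det (invmx T)).[z] != 0.
  by rewrite -det_mulmx mulmxV// det1 hornerC oner_eq0.
by rewrite hornerM mulf_eq0 negb_or => /andP[].
Qed.

End PolynomialMatrices.

Section PolynomialWienerHopf.
Variables (C : numFieldType) (n : nat).

(** The reversal is taken at a prescribed degree [k], which need not be the degree
    of [p]: in a matrix, all entries of a column are reversed at the same one. *)
Lemma rev_horner (p : {poly C}) (k : nat) (z : C) : (size p <= k.+1)%N -> z != 0 ->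
  p.[z] = (\poly_(l < k.+1) p`_(k - l)).[z^-1] * z ^+ k.
Proof.
move=> szp z0; rewrite (horner_coef_wide _ szp) horner_poly big_distrl /=.
rewrite (reindex_inj rev_ord_inj) /=; apply: eq_bigr => i _.
have ik : (i <= k)%N by rewrite -ltnS.
by rewrite subSS -mulrA exprVn; congr (_ * _); rewrite mulrC -expfB_cond ?(negPf z0).
Qed.

(** Column reducedness is used in one place only: the value at 0 of the reversed
    matrix [M] is the leading coefficient matrix, so that [\det M] does not vanish
    at 0.  At the other points of the disk this is the absence of zeros of the
    determinant of the left factor on and outside the circle. *)
Theorem polynomial_wiener_hopf (Q : 'M[{poly C}]_n) :
  (forall z, `|z| = 1 -> (\det Q).[z] != 0) ->
  exists (M G : 'M[{poly C}]_n) (k : 'I_n -> nat), [/\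
    forall w, `|w| <= 1 -> (\det M).[w] != 0,
    forall z, `|z| <= 1 -> (\det G).[z] != 0 &
    forall z, z != 0 -> mxeval z Q =
      mxeval z^-1 M *m diag_mx (\row_j (z ^+ k j)) *m mxeval z G].
Proof.
move=> Qcirc.
have Q0 : \det Q != 0.
  by apply: contraNneq (Qcirc 1 (normr1 _)) => ->; rewrite horner0.
have [Q1 [E [QE Q1S ES]]] := root_splitting (fun z => ~ `|z| <= 1) Q0.
have Q10 : \det Q1 != 0.
  by apply: contraNneq Q0; rewrite QE det_mulmx => ->; rewrite mul0r.
have [U [k [U1 szk lead]]] :
    exists U (k : 'I_n -> nat), [/\ U \in unitmx,
    forall i j, (size ((Q1 *m U) i j) <= (k j).+1)%N &
    \det (colcoef (Q1 *m U) k) != 0].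
  apply: (@column_reduction _ _ _ (fun j => \max_i size (Q1 i j))) => // i j.
  by rewrite leqW// (leq_bigmax (F := fun i => size (Q1 i j)) i).
pose M : 'M[{poly C}]_n :=
  \matrix_(i, j) \poly_(l < (k j).+1) ((Q1 *m U) i j)`_(k j - l).
have ME z : z != 0 ->
    mxeval z (Q1 *m U) = mxeval z^-1 M *m diag_mx (\row_j (z ^+ k j)).
  move=> z0; apply/matrixP => i j; rewrite mul_mx_diag [LHS]mxE [RHS]mxE.
  by rewrite [X in X * _]mxE [M i j]mxE [X in _ * X]mxE; exact: rev_horner.
exists M, (invmx U *m E), k; split.
- move=> w w1; have [->|w0] := eqVneq w 0.
    rewrite -det_mxeval (_ : mxeval 0 M = colcoef (Q1 *m U) k)//.
    apply/matrixP => i j; rewrite [LHS]mxE [M i j]mxE [RHS]mxE.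
    rewrite /horner_eval horner_poly big_ord_recl.
    by rewrite subn0 expr0 mulr1 big1 ?addr0// => l _; rewrite exprS mul0r mulr0.
  have wV0 : w^-1 != 0 by rewrite invr_eq0.
  have : (\det Q1).[w^-1] != 0.
    have [wV1|wV1] := eqVneq `|w^-1| 1.
      by have := Qcirc _ wV1; rewrite QE det_mulmx hornerM mulf_eq0 negb_or => /andP[].
    apply: Q1S => wV1'; move: wV1; rewrite normfV in wV1' *.
    by rewrite -(invr1 C) (inj_eq invr_inj) eq_le w1 /= -invf_le1 ?normr_gt0 // wV1'.
  have : (\det U).[w^-1] != 0.
    have : (\det U * \det (invmx U)).[w^-1] != 0.
      by rewrite -det_mulmx mulmxV// det1 hornerC oner_eq0.
    by rewrite hornerM mulf_eq0 negb_or => /andP[].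
  move=> Uw Qw; have := mulf_neq0 Qw Uw.
  rewrite -hornerM -det_mulmx -det_mxeval ME// det_mulmx invrK det_mxeval.
  by rewrite mulf_eq0 negb_or => /andP[].
- move=> z z1; rewrite det_mulmx hornerM mulf_neq0//; last by apply: ES => /(_ z1).
  have : (\det U * \det (invmx U)).[z] != 0.
    by rewrite -det_mulmx mulmxV// det1 hornerC oner_eq0.
  by rewrite hornerM mulf_eq0 negb_or => /andP[].
- move=> z z0; rewrite mxevalM mulmxA -ME// -mxevalM -mxevalM; congr mxeval.
  by rewrite mulmxK.
Qed.

End PolynomialWienerHopf.

(** * Characters of the solenoid *)

Section Characters.
Variable R : realType.
Implicit Types (u : solenoid R) (p q : rat).

Lemma chiD p q u : chi (p + q) u = chi p u * chi q u.
Proof.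
have N0 : (0 < `|denq p| * `|denq q|)%N by rewrite muln_gt0 !absz_denq_gt0.
pose L : level := exist _ (`|denq p| * `|denq q|)%N N0.
have absE (x : rat) : (`|denq x|%N)%:R = (denq x)%:~R :> rat.
  by rewrite -[in RHS](gtz0_abs (denq_gt0 x)).
have d0 (x : rat) : (denq x)%:~R != 0 :> rat by rewrite intr_eq0 denq_neq0.
have pE : p = (numq p * denq q)%:~R / (val L)%:R.
  by rewrite /= natrM !absE intrM -mulf_div divff// mulr1 divq_num_den.
have qE : q = (numq q * denq p)%:~R / (val L)%:R.
  rewrite /= natrM !absE intrM [X in _ / X]mulrC -mulf_div divff//.
  by rewrite mulr1 divq_num_den.
have pqE : p + q = (numq p * denq q + numq q * denq p)%:~R / (val L)%:R.
  by rewrite intrD mulrDl -pE -qE.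
have chip : chi p u = u L ^ (numq p * denq q) by rewrite {1}pE chi_frac.
have chiq : chi q u = u L ^ (numq q * denq p) by rewrite {1}qE chi_frac.
by rewrite pqE chip chiq chi_frac expfzDr// thread_neq0.
Qed.

Lemma chi0 u : chi 0 u = 1.
Proof.
have := chiD 0 0 u; rewrite addr0 -[LHS]mulr1.
by move/(mulfI (chi_neq0 0 u)) => <-.
Qed.

Lemma chiMn (k : nat) q u : chi (k%:R * q) u = chi q u ^+ k.
Proof.
elim: k => [|k IH]; first by rewrite mul0r chi0.
by rewrite -natr1 mulrDl mul1r chiD IH exprSr.
Qed.

Lemma chiN q u : chi (- q) u = (chi q u)^-1.
Proof.
by apply: (mulIf (chi_neq0 q u)); rewrite -chiD addNr chi0 mulVf ?chi_neq0.
Qed.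

Lemma cis_surj (z : R[i]) : `|z| = 1 -> exists x : R, cis x = z.
Proof.
case: z => a b; rewrite normc_def /= => /(congr1 (@complex.Re R)) /= s1.
have ab1 : a ^+ 2 + b ^+ 2 = 1.
  have ab0 : 0 <= a ^+ 2 + b ^+ 2 by rewrite addr_ge0 ?sqr_ge0.
  by rewrite -(sqr_sqrtr ab0) s1 expr1n.
have a1 : -1 <= a <= 1.
  by rewrite -ler_norml -sqrtr_sqr -sqrtr1 ler_wsqrtr// -ab1 lerDl sqr_ge0.
have bE : Num.sqrt (1 - a ^+ 2) = `|b|.
  by rewrite -ab1 addrC addKr sqrtr_sqr.
have [b0|b0] := leP 0 b.
  by exists (acos a); rewrite /cis acosK// sin_acos// bE ger0_norm.
exists (- acos a).
by rewrite /cis cosN sinN acosK// sin_acos// bE ltr0_norm// opprK.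
Qed.

(** The one-parameter subgroup [loop] already covers the circle under every
    nontrivial character. *)
Lemma chi_surj q (z : R[i]) : q != 0 -> `|z| = 1 ->
  exists u : solenoid R, chi q u = z.
Proof.
move=> q0 /cis_surj[x <-].
exists (loop (x / (pi *+ 2 * ratr q))); rewrite chi_loop; congr cis.
rewrite mulrAC mulrC divfK// mulf_neq0 ?fmorph_eq0//.
by rewrite mulrn_eq0 /= gt_eqF ?pi_gt0.
Qed.

End Characters.

(** * Absolutely convergent matrix power series on the circle *)

Section PowerSeries.
Variables (R : realType) (n : nat) (N : submult_norm R n).
Local Notation C := R[i].
Implicit Types (F : C -> 'M[C]_n) (M : nat -> 'M[C]_n) (a w z : C).

Lemma mxnormZr a A : N (a *: A) = complex.Re `|a| * N A.
Proof.
by apply: (@complexI R); rewrite mxnormZ rmorphM /=; case: a => x y; rewrite normc_def.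
Qed.

(** Absolute convergence is expressed by bounded partial sums of norms; the sum
    [F] is given rather than constructed, which dispenses with completeness of
    the matrix space. *)
Definition power_series F M : Prop :=
  (exists K : R, forall m, \sum_(k < m) N (M k) <= K) /\
  forall w, `|w| = 1 ->
    (fun m => N (F w - \sum_(k < m) w ^+ k *: M k)) @ \oo --> (0 : R).

Lemma eq_power_series F F' M : (forall w, `|w| = 1 -> F w = F' w) ->
  power_series F M -> power_series F' M.
Proof. by move=> FF' [MK FM]; split=> // w w1; rewrite -FF'//; exact: FM. Qed.

Lemma power_series_poly (G : 'M[{poly C}]_n) :
  power_series (fun w => mxeval w G) (fun k => map_mx (coefp k) G).
Proof.
pose s := (\max_i \max_j size (G i j))%N.
have szG i j : (size (G i j) <= s)%N.
  by rewrite (leq_trans _ (leq_bigmax i))// (leq_bigmax (F := fun j => size (G i j)) j).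
split.
  exists (\sum_(k < s) N (map_mx (coefp k) G)) => m.
  rewrite -!(big_mkord xpredT (fun k => N (map_mx (coefp k) G))).
  have [ms|sm] := leqP m s.
    rewrite [leRHS](big_cat_nat (leq0n _) ms)//= lerDl sumr_ge0// => k _.
    exact: mxnorm_ge0.
  rewrite (big_cat_nat (leq0n _) (ltnW sm))//= -[leRHS]addr0 lerD// big_nat_cond big1// => k.
  rewrite andbT => /andP[sk _]; rewrite (_ : map_mx _ _ = 0) ?mxnorm0//.
  apply/matrixP => i j; rewrite !mxE /coefp/= nth_default//.
  exact: leq_trans (szG i j) sk.
move=> w _; apply: (@cvg_trans _ (cst (0 : R) @ \oo)); last exact: cvg_cst.
apply: near_eq_cvg; exists s => // m /= sm.
rewrite (_ : _ - _ = 0) ?mxnorm0//; apply/eqP; rewrite subr_eq0; apply/eqP.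
apply/matrixP => i j; rewrite summxE mxE /horner_eval.
rewrite (horner_coef_wide _ (leq_trans (szG i j) sm)).
by apply: eq_bigr => k _; rewrite !mxE mulrC.
Qed.

Lemma summable_cvg0 M (K : R) : (forall m, \sum_(k < m) N (M k) <= K) ->
  (fun k => N (M k)) @ \oo --> (0 : R).
Proof.
move=> MK; apply: cvg_series_cvg_0; apply: nondecreasing_is_cvgn.
  by apply: nondecreasing_series => k *; exact: mxnorm_ge0.
by exists K => _ [m _ <-]; rewrite /series /= big_mkord.
Qed.

(** Coefficients of the formal quotient of the series with coefficients [M] by
    [1 - a 'X]: comparing coefficients in [g (1 - a 'X) = M] gives the recursion. *)
Fixpoint geometric_quotient a M k : 'M[C]_n :=
  if k is k'.+1 then M k + a *: geometric_quotient a M k' else M 0.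

Lemma geometric_quotient_partial a w M m :
  (1 - a * w) *: \sum_(k < m.+1) w ^+ k *: geometric_quotient a M k =
  \sum_(k < m.+1) w ^+ k *: M k - (a * w ^+ m.+1) *: geometric_quotient a M m.
Proof.
elim: m => [|m IH].
  by rewrite !big_ord1 !expr0 !scale1r scalerBl scale1r expr1.
rewrite big_ord_recr [in RHS]big_ord_recr /= scalerDr IH; move: (\sum_(k < _) _) => S.
rewrite [_ *: (_ + _)]scalerDr; move: (geometric_quotient a M m) (M m.+1) => g f.
by apply/matrixP => i j; rewrite !mxE [w ^+ m.+2]exprSr; ring.
Qed.

(** Summing the recursion shows that the sums [s] of the norms of the quotient
    coefficients satisfy [s <= K + |a| s], hence are at most [K / (1 - |a|)].  In
    particular the coefficients tend to 0, so the remainder term in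
    [geometric_quotient_partial] does too, and convergence of the quotient series
    follows from that of [F]. *)
Lemma power_series_div1 a F M : `|a| < 1 -> power_series F M ->
  power_series (fun w => (1 - a * w)^-1 *: F w) (geometric_quotient a M).
Proof.
move=> a1 [[K MK] FM]; set g := geometric_quotient a M.
set ra := complex.Re `|a|.
have ra1 : ra < 1.
  by rewrite /ra; case: a a1 {g ra} => x y; rewrite normc_def -(ltcR _ 1).
have ra0 : 0 <= ra by rewrite /ra; case: (a) => x y; rewrite normc_def /= sqrtr_ge0.
have gK m : \sum_(k < m) N (g k) <= K / (1 - ra).
  rewrite ler_pdivlMr ?subr_gt0//.
  have step : \sum_(k < m.+1) N (g k) <= \sum_(k < m.+1) N (M k) +
      ra * \sum_(k < m) N (g k).
    rewrite big_ord_recl [X in _ <= X + _]big_ord_recl -addrA lerD2l mulr_sumr.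
    rewrite -big_split /= ler_sum// => k _.
    by rewrite (le_trans (mxnormD _ _ _))// mxnormZr.
  have := MK m.+1; have := mxnorm_ge0 N (g m).
  move: step; rewrite big_ord_recr /=; lra.
split; first by exists (K / (1 - ra)).
move=> w w1; have aw1 : 1 - a * w != 0.
  rewrite subr_eq0; apply: contraTneq a1 => aw.
  by have := congr1 Num.norm aw; rewrite normrM w1 normr1 mulr1 => <-; rewrite ltxx.
rewrite -cvg_shiftS /=.
set b := complex.Re `|(1 - a * w)^-1|.
have h : (fun m => b * (N (F w - \sum_(k < m.+1) w ^+ k *: M k) + N (g m)))
    @ \oo --> b * (0 + 0).
  apply: cvgM; first exact: cvg_cst.
  apply: cvgD (summable_cvg0 gK); by have := FM w w1; rewrite -cvg_shiftS.
rewrite addr0 mulr0 in h; apply: (squeeze_cvgr _ (cvg_cst (0 : R)) h).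
apply: nearW => m; rewrite mxnorm_ge0 /=.
(* Move the quotient series under the factor (1 - a w)^-1 as well. *)
have SE (S : 'M[C]_n) : S = (1 - a * w)^-1 *: ((1 - a * w) *: S).
  by rewrite scalerA mulVf// scale1r.
rewrite [X in _ - X]SE -scalerBr mxnormZr.
rewrite geometric_quotient_partial opprD opprK addrA.
have b0 : 0 <= b.
  by rewrite /b; case: (_^-1) => x y; rewrite normc_def /= sqrtr_ge0.
rewrite ler_wpM2l// (le_trans (mxnormD _ _ _))// lerD2l mxnormZr.
rewrite normrM normrX w1 expr1n mulr1 -/ra -[leRHS]mul1r ler_wpM2r ?mxnorm_ge0//.
exact: ltW.
Qed.

Lemma power_series_div_prod (s : seq C) F M :
  (forall a, a \in s -> `|a| < 1) -> power_series F M ->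
  exists M', power_series (fun w => (\prod_(a <- s) (1 - a * w))^-1 *: F w) M'.
Proof.
elim: s => [|a s IH] s1 FM.
  exists M; apply: eq_power_series FM => w _.
  by rewrite big_nil invr1 scale1r.
have [|M' FM'] := IH _ FM; first by move=> b bs; rewrite s1// inE bs orbT.
exists (geometric_quotient a M'); apply: eq_power_series
  (power_series_div1 (s1 a (mem_head _ _)) FM') => w _.
by rewrite big_cons invfM scalerA.
Qed.

(** Over the complex numbers [p] is, up to a nonzero constant, the product of the
    factors [1 - b^-1 w] over its roots [b], and [|b^-1| < 1]. *)
Lemma power_series_div (p : {poly C}) F M :
  (forall z, `|z| <= 1 -> p.[z] != 0) -> power_series F M ->
  exists M', power_series (fun w => p.[w]^-1 *: F w) M'.
Proof.
move=> p1 FM; have [s ps] := closed_field_poly_normal p.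
have lp : lead_coef p != 0.
  rewrite lead_coef_eq0; apply: contraNneq (p1 0 _) => [->|].
    by rewrite horner0.
  by rewrite normr0 ler01.
have s1 b : b \in s -> ~~ (`|b| <= 1).
  move=> bs; apply/negP => /p1/negP; apply; rewrite ps hornerZ mulf_eq0.
  by apply/orP; right; rewrite -/(root _ b) root_prod_XsubC.
pose c := lead_coef p * \prod_(b <- s) - b.
have [M' FM'] : exists M', power_series
    (fun w => (\prod_(a <- [seq b^-1 | b <- s]) (1 - a * w))^-1 *: (c^-1 *: F w)) M'.
  apply: (@power_series_div_prod _ _ (fun k => c^-1 *: M k)).
    move=> _ /mapP[b bs ->]; have := s1 b bs.
    rewrite -real_ltNge ?normr_real ?real1// => b1.
    by rewrite normfV invf_lt1// (lt_trans ltr01).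
  case: FM => [[K MK] FM]; split.
    exists (complex.Re `|c^-1| * K) => m.
    under eq_bigr do rewrite mxnormZr.
    rewrite -mulr_sumr ler_wpM2l//.
    by case: (c^-1) => x y; rewrite normc_def /= sqrtr_ge0.
  move=> w w1; have := cvgM (cvg_cst (complex.Re `|c^-1|)) (FM w w1).
  rewrite mulr0 => h; apply: (cvg_trans _ (h _ _)); apply: near_eq_cvg; apply: nearW => m /=.
  rewrite -mxnormZr scalerBr scaler_sumr; congr (N (_ - _)).
  by apply: eq_bigr => k _; rewrite !scalerA mulrC.
exists M'; apply: eq_power_series FM' => w w1; rewrite scalerA -invfM.
congr (_^-1 *: _); rewrite [in RHS]ps hornerZ horner_prod /c mulrCA; congr (_ * _).
rewrite big_map -big_split big_seq [RHS]big_seq; apply: eq_bigr => b /s1 bs /=.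
have b0 : b != 0 by apply: contraNneq bs => ->; rewrite normr0 ler01.
by rewrite hornerXsubC [LHS]mulrC mulrBr mulr1 mulNr opprK mulrA mulfV// mul1r addrC.
Qed.

End PowerSeries.

(** * Expansions over the rationals *)

Section Expansions.
Variables (R : realType) (n : nat) (N : submult_norm R n).
Local Notation C := R[i].
Implicit Types (f g : solenoid R -> 'M[C]_n) (c : rat -> 'M[C]_n).
Implicit Types (M : nat -> 'M[C]_n) (F G : {fset rat}) (u : solenoid R) (r : nat -> rat).

Lemma esum_le_fset (a : rat -> R) (K : R) :
  (forall G, \sum_(q <- G) a q <= K) ->
  (\esum_(q in [set: rat]) (a q)%:E <= K%:E)%E.
Proof.
move=> aK; apply: ge_ereal_sup => _ [X [finX _] <-].
by rewrite fsbig_finite//= sumEFin lee_fin.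
Qed.

Lemma fset_le_esum (a : rat -> R) : (forall q, 0 <= a q) ->
  (\esum_(q in [set: rat]) (a q)%:E < +oo)%E ->
  exists K : R, forall G, \sum_(q <- G) a q <= K.
Proof.
move=> a0 afin; exists (fine (\esum_(q in [set: rat]) (a q)%:E)%E) => G.
rewrite -lee_fin fineK; last first.
  by rewrite ge0_fin_numE// esum_ge0// => q _; rewrite lee_fin.
apply: esum_ge; exists [set` G]; first by split.
by rewrite fsbig_finite//= set_fsetK sumEFin.
Qed.

Lemma perm_fset_split (s : seq rat) G : uniq s -> {subset s <= G} ->
  perm_eq (enum_fset G) (s ++ [seq q <- enum_fset G | q \notin s]).
Proof.
move=> us sG; apply: uniq_perm; first exact: fset_uniq.
  rewrite cat_uniq us filter_uniq ?fset_uniq// andbT /=.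
  by apply/hasPn => q; rewrite mem_filter => /andP[].
move=> q; rewrite mem_cat mem_filter.
by have [/sG ->|//] := boolP (q \in s).
Qed.

Lemma wiener_expansion_norm f c (K : R) u : wiener_expansion N f c ->
  (forall G, \sum_(q <- G) N (c q) <= K) -> N (f u) <= K.
Proof.
move=> [_ fc] cK; apply/ler_addgt0Pl => e e0.
have /cvgrPdist_lt /(_ _ e0) [G _ /(_ G (fsubset_refl _))] := fc u.
rewrite /= sub0r normrN ger0_norm ?mxnorm_ge0// => /ltW fG.
rewrite -(subrK (\sum_(q <- G) chi q u *: c q) (f u)).
rewrite (le_trans (mxnormD _ _ _))// lerD// (le_trans _ (cK G))//.
rewrite (le_trans (mxnorm_sum _ _ _ _))// ler_sum// => q _.
by rewrite mxnormZ1// normr_chi.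
Qed.

Lemma wiener_expansion_remainder f c F : wiener_expansion N f c ->
  wiener_expansion N (fun u => f u - \sum_(q <- F) chi q u *: c q)
    (fun q => if q \in F then 0 else c q).
Proof.
move=> [cfin fc]; split.
  apply: le_lt_trans cfin; apply: le_esum => q _; rewrite lee_fin.
  by case: ifP; rewrite ?mxnorm0 ?mxnorm_ge0.
move=> u; apply: (cvg_trans _ (fc u)); apply: near_eq_cvg.
exists F => // G FG /=; congr (N _); rewrite -addrA -opprD; congr (_ - _).
rewrite !(perm_big _ (perm_fset_split (fset_uniq F) (fsubsetP FG))) /= !big_cat /=.
congr (_ + _); rewrite [X in _ = X + _]big1_seq ?add0r; last first.
  by move=> q /andP[_ ->]; rewrite scaler0.
by rewrite !big_filter; apply: eq_bigr => q /negPf ->.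
Qed.

Lemma wienerD f g : wiener N f -> wiener N g -> wiener N (fun u => f u + g u).
Proof.
move=> fW gW; have := wienerB fW (wienerB (wienerB gW gW) gW).
by congr wiener; apply/funext => u; rewrite subrr sub0r opprK.
Qed.

(** For injective [r], the coefficient family on all rationals that takes the value
    [M k] at [r k] and vanishes off the range of [r]. *)
Definition seq_coef r (M : nat -> 'M[C]_n) q : 'M[C]_n :=
  let k := xget 0%N [set k | r k = q] in if r k == q then M k else 0.

Lemma seq_coefE r M k : injective r -> seq_coef r M (r k) = M k.
Proof.
move=> rI; rewrite /seq_coef; have -> : xget 0%N [set k' | r k' = r k] = k.
  by apply: xget_unique => // k' /rI.
by rewrite eqxx.
Qed.

Lemma seq_coef_neq0 r M q : seq_coef r M q != 0 -> exists k, q = r k.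
Proof.
rewrite /seq_coef; case: ifP => [/eqP <- _|]; last by rewrite eqxx.
by exists (xget 0%N [set k | r k = q]).
Qed.

(** Comparison of sums over finite sets of rationals with sums over intervals of
    indices: with [m0 = 0] it bounds the Wiener norm, and with large [m0] it bounds
    the tails in the convergence along finite sets. *)
Lemma seq_coef_sum r M (H : seq rat) (m0 : nat) : uniq H ->
  (forall k, (k < m0)%N -> r k \notin H) ->
  exists m, \sum_(q <- H) N (seq_coef r M q) <= \sum_(m0 <= k < m) N (M k).
Proof.
move=> uH Hm0; pose idx q := xget 0%N [set k | r k = q].
exists (\max_(q <- H) idx q).+1; set m := _.+1.
have le1 q : q \in H ->
    N (seq_coef r M q) <= \sum_(m0 <= k < m | r k == q) N (M k).
  move=> qH; rewrite /seq_coef -/(idx q); case: ifP => [rq|_]; last first.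
    by rewrite mxnorm0 sumr_ge0// => k _; exact: mxnorm_ge0.
  rewrite big_mkcond (bigD1_seq (idx q)) ?iota_uniq//=; last first.
    rewrite mem_index_iota ltnS leq_bigmax_seq// andbT leqNgt.
    by apply/negP => /Hm0; rewrite (eqP rq) qH.
  rewrite rq lerDl sumr_ge0// => k _.
  by case: ifP => // _; exact: mxnorm_ge0.
apply: (@le_trans _ _ (\sum_(q <- H) \sum_(m0 <= k < m | r k == q) N (M k))).
  by rewrite big_seq [leRHS]big_seq ler_sum.
rewrite (exchange_big_dep xpredT) //= ler_sum// => k _.
have [kH|kH] := boolP (r k \in H).
  rewrite big_mkcond (bigD1_seq (r k))//= eqxx big1 ?addr0// => q qk.
  by rewrite eq_sym (negPf qk).
rewrite big_seq_cond big_pred0 ?mxnorm_ge0// => q /=.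
by apply/andP => -[qH /eqP qk]; rewrite qk qH in kH.
Qed.

(** For an absolutely convergent series, convergence of the partial sums in one
    order gives unconditional convergence. *)
Lemma wiener_expansion_seq r M f (K : R) : injective r ->
  (forall m, \sum_(k < m) N (M k) <= K) ->
  (forall u, (fun m => N (f u - \sum_(k < m) chi (r k) u *: M k)) @ \oo
     --> (0 : R)) ->
  wiener_expansion N f (seq_coef r M).
Proof.
move=> rI MK fM; split.
  apply: (le_lt_trans _ (ltry K)); apply: esum_le_fset => G.
  have [|m /le_trans] := @seq_coef_sum r M (enum_fset G) 0 (fset_uniq G); first by [].
  by apply; rewrite big_mkord.
move=> u; apply/cvgrPdist_lt => e e0.
have e20 : 0 < e / 2 by rewrite divr_gt0.
pose S := series (fun k => N (M k)).
have Sincr : nondecreasing_seq S.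
  by apply: nondecreasing_series => k *; exact: mxnorm_ge0.
have Scvg : cvgn S.
  apply: nondecreasing_is_cvgn => //.
  by exists K => _ [m _ <-]; rewrite /S /series /= big_mkord.
have Stail : \forall m \near \oo, limn S - S m < e / 2.
  have /cvgrPdist_lt /(_ _ e20) := Scvg; apply: filterS => m.
  by apply: le_lt_trans; exact: ler_norm.
have fMu : \forall m \near \oo, N (f u - \sum_(k < m) chi (r k) u *: M k) < e / 2.
  have /cvgrPdist_lt /(_ _ e20) := fM u; apply: filterS => m.
  by rewrite sub0r normrN ger0_norm// mxnorm_ge0.
have [m [Sm fm]] : exists m, limn S - S m < e / 2 /\
    N (f u - \sum_(k < m) chi (r k) u *: M k) < e / 2.
  by have [m _ /(_ m (leqnn _))] := filterI Stail fMu; exists m.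
(* Past the first m terms, what a finite set adds is a tail of the norms. *)
pose s := [seq r k | k <- iota 0 m].
have us : uniq s by rewrite map_inj_uniq// iota_uniq.
exists [fset q in s]%fset => // G sG /=.
rewrite sub0r normrN ger0_norm ?mxnorm_ge0//.
have subG : {subset s <= G}.
  by move=> q qs; apply: (fsubsetP sG); rewrite inE.
rewrite (perm_big _ (perm_fset_split us subG)) big_cat /= big_map.
have -> : \sum_(k <- iota 0 m) chi (r k) u *: seq_coef r M (r k) =
    \sum_(k < m) chi (r k) u *: M k.
  rewrite -(big_mkord xpredT (fun k => chi (r k) u *: M k)) /index_iota subn0.
  by apply: eq_bigr => k _; rewrite seq_coefE.
rewrite opprD addrA (le_lt_trans (mxnormD _ _ _))// mxnormN.
rewrite [e]splitr ltr_leD// (le_trans (mxnorm_sum _ _ _ _))//.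
set H := [seq _ <- _ | _].
have [||m' Hm'] := @seq_coef_sum r M H m.
- by rewrite filter_uniq ?fset_uniq.
- by move=> k km; rewrite mem_filter map_f ?mem_iota.
apply: (@le_trans _ _ (\sum_(q <- H) N (seq_coef r M q))).
  by rewrite ler_sum// => q _; rewrite mxnormZ1// normr_chi.
rewrite (le_trans Hm')//; have [mm'|m'm] := leqP m' m.
  by rewrite big_geq// ltW.
have Sm' := nondecreasing_cvgn_le Sincr Scvg m'.
have : S m' = S m + \sum_(m <= k < m') N (M k).
  by rewrite /S /series /= (big_cat_nat (leq0n _) (ltnW m'm)).
lra.
Qed.

Lemma wiener_expansion_power_series (F : C -> 'M[C]_n) M (p d : rat) : d != 0 ->
  power_series N F M ->
  wiener_expansion N (fun u => chi p u *: F (chi d u))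
    (seq_coef (fun k => p + k%:R * d) M).
Proof.
move=> d0 [[K MK] FM]; apply: (@wiener_expansion_seq _ _ _ K) => //.
  move=> k k' /addrI /(mulIf d0) /eqP; rewrite eqr_nat; exact/eqP.
move=> u; have := FM (chi d u) (normr_chi d u); apply: cvg_trans.
apply: near_eq_cvg; apply: nearW => m.
rewrite -[LHS](mxnormZ1 N _ (normr_chi p u)) scalerBr scaler_sumr.
by congr (N (_ - _)); apply: eq_bigr => k _; rewrite scalerA chiD chiMn.
Qed.

Lemma wiener_power_series (F : C -> 'M[C]_n) M (p d : rat) : d != 0 ->
  power_series N F M -> wiener N (fun u => chi p u *: F (chi d u)).
Proof. by move=> d0 FM; eexists; exact: wiener_expansion_power_series FM. Qed.

Lemma wiener_plus_power_series (F : C -> 'M[C]_n) M (d : rat) : 0 < d ->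
  power_series N F M -> wiener_plus N (fun u => F (chi d u)).
Proof.
move=> d0 FM; have := wiener_expansion_power_series 0 (lt0r_neq0 d0) FM.
under [X in wiener_expansion _ X]eq_fun do rewrite chi0 scale1r.
move=> FE; split; first by eexists; exact: FE.
move=> q q0; rewrite (wiener_coefE FE); apply/eqP/negPn/negP => /seq_coef_neq0[k qk].
by move: q0; rewrite qk add0r ltNge mulr_ge0// ltW.
Qed.

Lemma wiener_minus_power_series (F : C -> 'M[C]_n) M (d : rat) : d < 0 ->
  power_series N F M -> wiener_minus N (fun u => F (chi d u)).
Proof.
move=> d0 FM; have := wiener_expansion_power_series 0 (ltr0_neq0 d0) FM.
under [X in wiener_expansion _ X]eq_fun do rewrite chi0 scale1r.
move=> FE; split; first by eexists; exact: FE.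
move=> q q0; rewrite (wiener_coefE FE); apply/eqP/negPn/negP => /seq_coef_neq0[k qk].
by move: q0; rewrite qk add0r ltNge mulr_ge0_le0// ltW.
Qed.

End Expansions.

(** * Approximation by trigonometric polynomials *)

Section Approximation.
Variables (R : realType) (n : nat) (N : submult_norm R n).
Local Notation C := R[i].
Implicit Types (f g : solenoid R -> 'M[C]_n) (c : rat -> 'M[C]_n).
Implicit Types (F G : {fset rat}) (u : solenoid R).

(** [N] is not assumed to be an operator norm, so a fixed row vector [v = v X] is
    first repeated into a square matrix [V = V X], to which submultiplicativity
    applies. *)
Lemma det_1sub_neq0 (X : 'M[C]_n) : N X < 1 -> \det (1%:M - X) != 0.
Proof.
move=> X1; apply/det0P => -[v v0 vX].
have vE : v = v *m X by apply/eqP; rewrite -subr_eq0 -{1}(mulmx1 v) -mulmxBr vX.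
pose V : 'M[C]_n := \matrix_(i, j) v 0 j.
have VE : V = V *m X.
  apply/matrixP => i j; rewrite [LHS]mxE [in LHS]vE !mxE.
  by apply: eq_bigr => k _; rewrite mxE.
have V0 : 0 < N V.
  rewrite lt_neqAle mxnorm_ge0 andbT eq_sym; apply: contra v0 => /eqP /mxnorm_eq0 Vz.
  by apply/eqP/rowP => j; have := congr1 (fun A : 'M[C]_n => A j j) Vz; rewrite !mxE.
have := mxnormM N V X; rewrite -VE; apply/negP; rewrite -ltNge.
by rewrite gtr_pMr.
Qed.

Lemma wiener_truncation f (e : R) : wiener N f -> 0 < e ->
  exists F c, (wiener_norm N (fun u => (f u - \sum_(q <- F) chi q u *: c q)%R)
      <= e%:E)%E /\
    forall u, N (f u - \sum_(q <- F) chi q u *: c q) <= e.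
Proof.
move=> [c fc] e0; have [cfin _] := fc.
have [F Ftail] := esum_tail (fun q => mxnorm_ge0 N (c q)) e0 cfin.
have remE := wiener_expansion_remainder F fc.
have remK G : \sum_(q <- G) N (if q \in F then 0 else c q) <= e.
  apply: (le_trans _ (Ftail (F `|` G)%fset (fsubsetUl _ _))).
  rewrite (bigID (mem F))/= [X in X + _]big1 ?add0r; last first.
    by move=> q ->; rewrite mxnorm0.
  rewrite -big_filter; set s := [seq _ <- _ | _].
  have us : uniq s by rewrite filter_uniq ?fset_uniq.
  have sG : {subset s <= ((F `|` G) `\` F)%fset}.
    by move=> q; rewrite mem_filter !inE => /andP[-> ->]; rewrite orbT.
  rewrite (perm_big _ (perm_fset_split us sG)) big_cat /=.
  rewrite -[leLHS]addr0 lerD//; last first.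
    by rewrite sumr_ge0// => q _; exact: mxnorm_ge0.
  rewrite big_filter [leRHS]big_filter ler_sum// => q /negPf ->//.
exists F, c; split; first by rewrite (wiener_normE remE) esum_le_fset.
by move=> u; exact: (wiener_expansion_norm u remE remK).
Qed.

(** [L] is a common denominator of the frequencies, and [m] is large enough to make
    all the exponents [m + L q] nonnegative. *)
Lemma trig_polynomial F c : exists (L m : nat) (Q : 'M[{poly C}]_n),
  (0 < L)%N /\ forall u, \sum_(q <- F) chi q u *: c q =
    chi (- (m%:R * L%:R^-1)) u *: mxeval (chi (L%:R^-1) u) Q.
Proof.
pose L := (\prod_(q <- F) `|denq q|)%N.
have L0 : (0 < L)%N by apply: prodn_gt0 => q; apply: absz_denq_gt0.
have Lr0 : L%:R != 0 :> rat by rewrite pnatr_eq0 -lt0n.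
pose a (q : rat) : int := numq q * (L %/ `|denq q|)%:Z.
have aE q : q \in F -> (a q)%:~R = q * L%:R :> rat.
  move=> qF; have dL : (`|denq q| %| L)%N by rewrite /L (big_rem q)//= dvdn_mulr.
  rewrite /a intrM numqE -mulrA; congr (_ * _).
  by rewrite -{1}(gtz0_abs (denq_gt0 q)) -intrM -PoszM mulnC divnK.
pose m := (\sum_(q <- F) `|a q|)%N.
pose k q := `|(a q + m%:Z)%R|%N.
have kE q : q \in F -> q = - (m%:R * L%:R^-1) + (k q)%:R * L%:R^-1.
  move=> qF; have am : (`|a q| <= m)%N by rewrite /m (big_rem q)//= leq_addr.
  have am0 : 0 <= a q + m%:Z.
    rewrite -[m%:Z]opprK subr_ge0 lerNl (le_trans (ler_norm _))// normrN.
    by rewrite -abszE lez_nat.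
  have -> : (k q)%:R = q * L%:R + m%:R :> rat.
    by rewrite -aE// -[m%:R]/(m%:Z%:~R) -intrD -[in RHS](gez0_abs am0).
  by rewrite mulrDl mulfK// addrCA addNr addr0.
exists L, m, (\sum_(q <- F) map_mx (fun x => x%:P * 'X^(k q)) (c q)); split=> // u.
rewrite /mxeval [X in _ *: X]raddf_sum scaler_sumr.
rewrite big_seq [RHS]big_seq; apply: eq_bigr => q qF.
rewrite {1}(kE q qF) chiD chiMn -scalerA; congr (_ *: _).
by apply/matrixP => i j; rewrite !mxE /= /horner_eval hornerM hornerC hornerXn mulrC.
Qed.

End Approximation.

(** * Units *)

Section Units.
Variables (R : realType) (n : nat) (N : submult_norm R n).
Local Notation C := R[i].
Implicit Types (Q G : 'M[{poly C}]_n) (u : solenoid R).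

Lemma mxeval_mul_inv Q z : (\det Q).[z] != 0 ->
  let V := (\det Q).[z]^-1 *: mxeval z (\adj Q) in
  mxeval z Q *m V = 1%:M /\ V *m mxeval z Q = 1%:M.
Proof.
move=> Qz /=; rewrite mxeval_adj -det_mxeval -scalemxAr -scalemxAl.
rewrite mul_mx_adj mul_adj_mx; move: Qz; rewrite -det_mxeval => Qz.
by split; rewrite scale_scalar_mx mulVf.
Qed.

Lemma units_plus_mxeval G (d : rat) : 0 < d ->
  (forall z, `|z| <= 1 -> (\det G).[z] != 0) ->
  units_of (wiener_plus N) (fun u => mxeval (chi d u) G).
Proof.
move=> d0 G1; have [M GM] := power_series_div G1 (power_series_poly N (\adj G)).
split; first exact: wiener_plus_power_series d0 (power_series_poly N G).
exists (fun u => (\det G).[chi d u]^-1 *: mxeval (chi d u) (\adj G)).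
  exact: wiener_plus_power_series d0 GM.
by move=> u; apply: mxeval_mul_inv; apply: G1; rewrite normr_chi.
Qed.

Lemma units_minus_mxeval G (d : rat) : d < 0 ->
  (forall z, `|z| <= 1 -> (\det G).[z] != 0) ->
  units_of (wiener_minus N) (fun u => mxeval (chi d u) G).
Proof.
move=> d0 G1; have [M GM] := power_series_div G1 (power_series_poly N (\adj G)).
split; first exact: wiener_minus_power_series d0 (power_series_poly N G).
exists (fun u => (\det G).[chi d u]^-1 *: mxeval (chi d u) (\adj G)).
  exact: wiener_minus_power_series d0 GM.
by move=> u; apply: mxeval_mul_inv; apply: G1; rewrite normr_chi.
Qed.

Lemma mxeval_rev Q : exists Q' (k : nat), forall z, z != 0 ->
  mxeval z Q = z ^+ k *: mxeval z^-1 Q'.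
Proof.
pose k := (\max_i \max_j size (Q i j))%N.
exists (\matrix_(i, j) \poly_(l < k.+1) (Q i j)`_(k - l)), k => z z0.
apply/matrixP => i j; rewrite [LHS]mxE [RHS]mxE [in RHS]mxE [in RHS]mxE mulrC.
apply: rev_horner => //; rewrite leqW// (leq_trans _ (leq_bigmax i))//.
exact: (leq_bigmax (F := fun j => size (Q i j)) j).
Qed.

(** The roots of [p] inside and outside the circle form coprime factors [pi] and
    [po] of [p]; dividing [be * pi + al * po = 1] by [pi * po] gives the splitting. *)
Lemma bezout_splitting (p : {poly C}) : (forall z, `|z| = 1 -> p.[z] != 0) ->
  exists (s : seq C) (po al be : {poly C}),
    [/\ forall a, a \in s -> `|a| < 1, forall z, `|z| <= 1 -> po.[z] != 0 &
     forall z, `|z| = 1 ->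
       p.[z]^-1 = al.[z] / (\prod_(a <- s) (z - a)) + be.[z] / po.[z]].
Proof.
move=> pcirc; have [r pr] := closed_field_poly_normal p.
have lp : lead_coef p != 0.
  rewrite lead_coef_eq0; apply: contraNneq (pcirc 1 (normr1 _)) => ->.
  by rewrite horner0.
pose s := [seq a <- r | `|a| < 1]; pose t := [seq a <- r | ~~ (`|a| < 1)].
pose pi := \prod_(a <- s) ('X - a%:P).
pose po := lead_coef p *: \prod_(a <- t) ('X - a%:P).
have pE : p = pi * po.
  by rewrite {1}pr -scalerAr /pi !big_filter (bigID (fun a => `|a| < 1)).
have po1 z : `|z| <= 1 -> po.[z] != 0.
  move=> z1; rewrite hornerZ mulf_neq0//; apply/negP; rewrite -/(root _ z) root_prod_XsubC.
  rewrite mem_filter -real_leNgt ?normr_real ?real1// => /andP[z1' zr].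
  have /pcirc/negP : `|z| = 1 by apply/eqP; rewrite eq_le z1.
  apply; rewrite pr hornerZ mulf_eq0; apply/orP; right.
  by rewrite -/(root _ z) root_prod_XsubC.
have cop : coprimep pi po.
  rewrite /po coprimepZr// /pi; apply/Pdiv.ClosedField.coprimepP => x.
  rewrite root_prod_XsubC mem_filter => /andP[x1 _]; apply/negP.
  by rewrite -/(root _ x) root_prod_XsubC mem_filter x1.
have [[be al] /= E] := Bezout_eq1_coprimepP _ _ cop.
exists s, po, al, be; split=> //; first by move=> a; rewrite mem_filter => /andP[].
move=> z z1; have := pcirc z z1; rewrite pE hornerM mulf_eq0 negb_or => /andP[pi0 po0].
have -> : \prod_(a <- s) (z - a) = pi.[z].
  by rewrite /pi horner_prod; apply: eq_bigr => a _; rewrite hornerXsubC.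
have := congr1 (fun q : {poly C} => q.[z]) E.
rewrite hornerD !hornerM hornerC => Ez.
rewrite -[LHS]mul1r -Ez; by field; rewrite pi0 po0.
Qed.

(** The part with poles inside the circle is a power series in [w = z^-1]: there
    [z - a = z (1 - a w)], and the polynomial numerator is a power of [z] times a
    polynomial in [w].  The powers of [z] shift the frequencies. *)
Lemma wiener_inverse Q (p d : rat) : d != 0 ->
  (forall z, `|z| = 1 -> (\det Q).[z] != 0) ->
  wiener N (fun u => chi p u *: ((\det Q).[chi d u]^-1 *: mxeval (chi d u) (\adj Q))).
Proof.
move=> d0 Qcirc; have [s [po [al [be [s1 po1 E]]]]] := bezout_splitting Qcirc.
have [M1 PS1] := power_series_div po1 (power_series_poly N (be *: \adj Q)).
have [Q' [k Q'E]] := mxeval_rev (al *: \adj Q).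
have [M2 PS2] := power_series_div_prod s1 (power_series_poly N Q').
have dN0 : - d != 0 by rewrite oppr_eq0.
have := wienerD (wiener_power_series (p + (k%:R - (size s)%:R) * d) dN0 PS2)
  (wiener_power_series p d0 PS1).
congr wiener; apply/funext => u; set z := chi d u.
have z0 : z != 0 by exact: chi_neq0.
have evZ (x : {poly C}) : mxeval z (x *: \adj Q) = x.[z] *: mxeval z (\adj Q).
  by apply/matrixP => i j; rewrite !mxE /horner_eval hornerM.
rewrite [in RHS]E ?normr_chi// -/z evZ scalerDl scalerDr; congr (_ + _).
  (* The part with poles inside: expand in powers of z^-1. *)
  have prodE : \prod_(a <- s) (z - a) = z ^+ size s * \prod_(a <- s) (1 - a * z^-1).
    elim: (s) => [|a s' IH]; first by rewrite !big_nil mulr1.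
    rewrite !big_cons IH exprS mulrACA; congr (_ * _).
    by rewrite mulrBr mulr1 mulrCA divff// mulr1.
  rewrite (mulrC al.[z]) -[in RHS]scalerA -evZ Q'E// chiN -/z !scalerA; congr (_ *: _).
  rewrite prodE mulrBl chiD chiD chiN !chiMn -/z invfM; ring.
by rewrite !scalerA; congr (_ *: _); rewrite -mulrA (mulrC be.[z]).
Qed.

Lemma laurent_Lambda_W Q (p d : rat) : 0 < d ->
  (forall z, `|z| = 1 -> (\det Q).[z] != 0) ->
  Lambda_W N (fun u => chi p u *: mxeval (chi d u) Q).
Proof.
move=> d0 Qcirc.
have dn0 : d != 0 by rewrite gt_eqF.
split; first exact: wiener_power_series dn0 (power_series_poly N Q).
exists (fun u => chi (- p) u *:
  ((\det Q).[chi d u]^-1 *: mxeval (chi d u) (\adj Q))).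
  exact: wiener_inverse.
move=> u; have [] := mxeval_mul_inv (Qcirc _ (normr_chi d u)).
move: (_ *: mxeval _ (\adj Q)) => V QV VQ.
rewrite chiN -!scalemxAl -!scalemxAr !scalerA QV VQ.
by rewrite mulVf ?mulfV ?chi_neq0// scale1r.
Qed.

Lemma laurent_exact_factorization Q (p d : rat) : 0 < d ->
  (forall z, `|z| = 1 -> (\det Q).[z] != 0) ->
  exact_factorization N (fun u => chi p u *: mxeval (chi d u) Q).
Proof.
move=> d0 Qcirc.
have [M [G [k [M1 G1 E]]]] := polynomial_wiener_hopf Qcirc.
exists (fun u => mxeval (chi (- d) u) M), (fun u => mxeval (chi d u) G),
  (fun j => p + (k j)%:R * d); split.
- by apply: units_minus_mxeval; rewrite ?oppr_lt0.
- exact: units_plus_mxeval.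
- move=> u; rewrite E ?chi_neq0// chiN scalemxAl scalemxAr; congr (_ *m _ *m _).
  apply/matrixP => i j; rewrite !mxE chiD chiMn.
  by rewrite -mulrnAr.
Qed.

End Units.

(** * Density of factorizable loops *)

Theorem theorem5 (R : realType) (n : nat) (hn : (1 <= n)%N)
    (N : submult_norm R n) (A : solenoid R -> 'M[R[i]]_n)
    (hA : Lambda_W N A) (e : R) (he : 0 < e) :
  exists B : solenoid R -> 'M[R[i]]_n,
    [/\ Lambda_W N B, exact_factorization N B &
        (wiener_norm N (fun u => A u - B u)%R < e%:E)%E].
Proof.
have [AW [g [cg gE] Ag]] := hA.
have [K cgK] := fset_le_esum (fun q => mxnorm_ge0 N (cg q)) gE.1.
have gK u : N (g u) <= K by exact: wiener_expansion_norm gE cgK.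
have K0 : 0 <= K by have := cgK fset0; rewrite big_seq_fset0.
(* The second bound gives N (g u) * N (A u - B u) < 1 at every u. *)
pose e1 := Num.min (e / 2) (K + 1)^-1.
have e10 : 0 < e1 by rewrite lt_min divr_gt0//= invr_gt0 ltr_wpDl.
have Ke1 : K * e1 < 1.
  apply: (@le_lt_trans _ _ (K * (K + 1)^-1)).
    by rewrite ler_wpM2l// ge_min lexx orbT.
  by rewrite ltr_pdivrMr ?ltr_wpDl// mul1r ltrDl.
have [F [c [normAB AB]]] := wiener_truncation AW e10.
pose B u := \sum_(q <- F) chi q u *: c q.
have detB u : \det (B u) != 0.
  have : \det (1%:M - g u *m (A u - B u)) != 0.
    apply: (det_1sub_neq0 (N := N)); apply: le_lt_trans Ke1.
    by rewrite (le_trans (mxnormM _ _ _))// ler_pM ?mxnorm_ge0.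
  by rewrite mulmxBr (Ag u).2 subKr det_mulmx mulf_eq0 negb_or => /andP[].
have [L [m [Q [L0 BE]]]] := trig_polynomial F c.
have d0 : 0 < L%:R^-1 :> rat by rewrite invr_gt0 ltr0n.
have Qcirc z : `|z| = 1 -> (\det Q).[z] != 0.
  have dn0 : L%:R^-1 != 0 :> rat by rewrite gt_eqF.
  move=> /(chi_surj dn0)[u <-]; have := detB u.
  by rewrite /B BE detZ mulf_eq0 negb_or det_mxeval => /andP[].
have BP : B = fun u => chi (- (m%:R * L%:R^-1)) u *: mxeval (chi L%:R^-1 u) Q.
  exact/funext.
exists B; split; last first.
- apply: (le_lt_trans normAB).
  by rewrite lte_fin gt_min ltr_pdivrMr// ltr_pMr// ltr1n.
- by rewrite BP; exact: laurent_exact_factorization.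
- by rewrite BP; exact: laurent_Lambda_W.
Qed.
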